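(* Let $v>3$ and let $(V,B)$ be a Steiner Triple System $S(2,3,v)$. Let $k$ be a field and let $J_B\subseteq k[V]$ be the cover ideal of $B$. Then $$J_B^{(3)}\nsubseteq J_B^{2}.$$
   Context: A Steiner system of type $S(t,n,v)$ is a set $V$ with $|V|=v$ together with a collection $B$ of $n$-element subsets of $V$ (blocks) such that each $t$-element subset of $V$ is contained in a unique block; a Steiner Triple System is one of type $S(2,3,v)$. Let $k[V]$ be the polynomial ring over $k$ with variables $x_i$ indexed by $i\in V$. For $\sigma\subseteq V$ let $\mathfrak p_\sigma=(x_i : i\in\sigma)\subseteq k[V]$. The cover ideal of $B$ is $J_B=\bigcap_{\sigma\in B}\mathfrak p_\sigma$. For a radical ideal $J$, the $m$-th symbolic power is $J^{(m)}=\bigcap_{\mathfrak p\in\mathrm{Ass}(J)}\mathfrak p^m$. *)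

(* Defs.v *)
From mathcomp Require Import all_boot all_order all_algebra.
From mathcomp Require Import mpoly.
From mathcomp Require Import boolp classical_sets.

Set Implicit Arguments.
Unset Strict Implicit.
Unset Printing Implicit Defensive.

Import GRing.Theory.

Local Open Scope ring_scope.
Local Open Scope classical_set_scope.

Section Steiner.

Definition steiner_system (t n v : nat) (V : finType) (B : {set {set V}}) : Prop :=
  [/\ #|V| = v,
      (forall b : {set V}, b \in B -> #|b| = n)
    & (forall T : {set V}, #|T| = t ->
         exists! b : {set V}, b \in B /\ T \subset b)].

Definition steiner_triple_system (v : nat) (V : finType) (B : {set {set V}}) : Prop :=
  steiner_system 2 3 v B.

End Steiner.

Section Ideals.
Variable R : comNzRingType.
Implicit Types (A I J P : set R).

(* Unlike [idealr_closed], this allows the unit ideal. *)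
Definition ideal I : Prop :=
  [/\ I 0, (forall f g, I f -> I g -> I (f + g))
         & (forall a f, I f -> I (a * f))].

Definition ideal_gen A : set R := smallest ideal A.

Definition ideal_power I (m : nat) : set R :=
  ideal_gen [set f | exists2 u : 'I_m -> R,
                       (forall j, I (u j)) & f = \prod_(j < m) u j].

Definition prime_ideal P : Prop :=
  idealr_closed (mem P) /\ prime_idealr_closed (mem P).

(* Ass(J) denotes, as usual for an ideal, the associated primes of the module
   R/J: the primes of the form (J : f), the annihilator of the class of f. *)
Definition associated_primes J : set (set R) :=
  [set P | prime_ideal P /\ exists f : R, P = [set g | J (g * f)]].

(* This is the definition of the symbolic power for radical J. *)
Definition symbolic_power J (m : nat) : set R :=
  \bigcap_(P in associated_primes J) ideal_power P m.

End Ideals.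

Section CoverIdeal.
Variables (k : fieldType) (V : finType).

(* k[V]: the variable indexed by i : V is the one numbered [enum_rank i]. *)
Definition pvar (i : V) : {mpoly k[#|V|]} := 'X_(enum_rank i).

Definition var_ideal (s : {set V}) : set {mpoly k[#|V|]} :=
  ideal_gen [set f | exists2 i, i \in s & f = pvar i].

Definition cover_ideal (B : {set {set V}}) : set {mpoly k[#|V|]} :=
  \bigcap_(s in [set` B]) var_ideal s.

End CoverIdeal.

Arguments pvar k {V} i.
Arguments var_ideal k {V} s.
Arguments cover_ideal k {V} B.

(* Main.v *)
Require Import Defs.
From mathcomp Require Import all_boot all_order all_algebra.
From mathcomp Require Import mpoly.
From mathcomp Require Import boolp classical_sets.
From mathcomp Require Import zify.

(* The product [x_V] of all variables witnesses the non-inclusion. An associated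
   prime of [J_B] contains [J_B], hence all three variables of some block (else
   a product of variables, one outside it from each block, would lie in [J_B]),
   so [x_V] lies in its cube. As [x_V] is squarefree, membership in [J_B ^ 2]
   would give two disjoint vertex covers, i.e. a 2-colouring of [V] without
   monochromatic block, and a Steiner triple system with more than three points
   has none. *)

Set Implicit Arguments.
Unset Strict Implicit.
Unset Printing Implicit Defensive.

Import GRing.Theory.

(** * Third points and two-colourings of triple systems *)

Section ThirdPoint.
Import mathcomp.boot.fintype mathcomp.boot.finset.
Variables (V : finType) (B : {set {set V}}).
Hypothesis blocks3 : forall b, b \in B -> #|b| = 3.
Hypothesis blocks_cover : forall T : {set V}, #|T| = 2 ->
  exists! b : {set V}, b \in B /\ T \subset b.

(** This is the product of the idempotent Steiner quasigroup: as blocks have three points, the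
    default [x] is taken exactly when [x = y]. *)
Definition third_point (x y : V) : V :=
  odflt x [pick z | [&& z != x, z != y & [set x; y; z] \in B]].

Lemma third_pointP x y : x != y ->
  [/\ third_point x y != x, third_point x y != y
    & [set x; y; third_point x y] \in B].
Proof.
move=> xy; rewrite /third_point; case: pickP => [z /and3P[] //|noz].
have [b [[bB xyb] _]] : exists! b : {set V}, b \in B /\ [set x; y] \subset b.
  by apply: blocks_cover; rewrite cards2 xy.
have : #|b :\: [set x; y]| == 1.
  by rewrite cardsD (setIidPr xyb) blocks3 // cards2 xy.
case/cards1P => z bz.
have zb : z \in b :\: [set x; y] by rewrite bz set11.
move: zb; rewrite !inE negb_or -andbA => /and3P[zx zy _].
have := noz z; rewrite zx zy /= => /negP[].
by rewrite -bz -[X in X :|: _](setIidPr xyb) setID.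
Qed.

(** Blocks through the pair [x], [y] coincide, so [z] lies in the block of [third_point x y]. *)
Lemma third_point_unique x y z : x != y -> z != x -> z != y ->
  [set x; y; z] \in B -> third_point x y = z.
Proof.
move=> xy zx zy zB; have [tx ty tB] := third_pointP xy.
have [b [_ b_uniq]] : exists! b : {set V}, b \in B /\ [set x; y] \subset b.
  by apply: blocks_cover; rewrite cards2 xy.
have: z \in [set x; y; third_point x y].
  rewrite -(b_uniq _ (conj tB (subsetUl _ _))).
  by rewrite (b_uniq _ (conj zB (subsetUl _ _))) !inE eqxx orbT.
by rewrite !inE (negPf zx) (negPf zy) => /eqP.
Qed.

Lemma third_pointC x y : x != y -> third_point y x = third_point x y.
Proof.
move=> xy; have [tx ty tB] := third_pointP xy.
by apply: third_point_unique => //; rewrite 1?eq_sym // (setUC [set y]).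
Qed.

(** The block through [x] and [third_point x y] is again the one through [x] and [y], so its
    remaining point is [y]. *)
Lemma third_pointK x y : x != y -> third_point x (third_point x y) = y.
Proof.
move=> xy; have [tx ty tB] := third_pointP xy.
by apply: third_point_unique; [rewrite eq_sym..|rewrite setUAC].
Qed.

Lemma third_point_inj x (S : {set V}) :
  {in S :\ x &, injective (third_point x)}.
Proof.
move=> y z; rewrite !inE => /andP[yx _] /andP[zx _] yz.
by rewrite -[y](third_pointK (x := x)) 1?eq_sym // yz third_pointK // eq_sym.
Qed.

(** Equivalently, [S] and [~: S] are both vertex covers of [B]. *)
Definition bichromatic (S : {set V}) :=
  forall b, b \in B -> exists x y, [/\ x \in b, y \in b, x \in S & y \notin S].

Lemma bichromaticC S : bichromatic S -> bichromatic (~: S).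
Proof.
by move=> bS b /bS[x [y [xb yb xS yS]]]; exists y, x; rewrite !inE xS yS.
Qed.

Lemma third_point_bichromatic S x y : bichromatic S -> x != y ->
  x \in S -> y \in S -> third_point x y \notin S.
Proof.
move=> bS xy xS yS; apply/negP => tS.
have [_ _ /bS[_ [z [_ zb _ /negP[]]]]] := third_pointP xy.
by move: zb; rewrite !inE -orbA => /or3P[] /eqP->.
Qed.

Lemma sub_third_point S x : bichromatic S -> x \in S ->
  third_point x @: (S :\ x) \subset ~: S.
Proof.
move=> bS xS; apply/subsetP => _ /imsetP[y + ->]; rewrite !inE => /andP[yx yS].
by apply: third_point_bichromatic; rewrite // eq_sym.
Qed.

Lemma card_third_point (S : {set V}) x : x \in S ->
  #|third_point x @: (S :\ x)|.+1 = #|S|.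
Proof.
move=> xS; rewrite card_in_imset; last exact: third_point_inj.
by rewrite (cardsD1 x S) xS.
Qed.

(* Suppose [#|S| <= #|~: S|]. For [c, d] outside [S], the third point [x] of
   their block lies in [S]; since [third_point x] embeds [S :\ x] in [~: S] and
   misses [c] and [d], [#|~: S| = #|S|.+1] and nothing else is missed. But any
   further point [e] outside [S] is missed too, as [third_point e] then maps
   [~: S :\ e] bijectively onto [S]. *)
Lemma bichromatic_card S : bichromatic S -> #|V| <= 3.
Proof.
move=> bS; wlog leS : S bS / #|S| <= #|~: S|.
  move=> wlg; have [/wlg|/ltnW le] := leqP #|S| #|~: S|; first exact.
  by apply: (wlg (~: S)); [apply: bichromaticC | rewrite setCK].
rewrite leqNgt; apply/negP => V_gt3.
have cardS := cardsC S.
have bS' := bichromaticC bS.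
have /card_gt1P[c [d [cS dS cd]]] : 1 < #|~: S| by lia.
have xS : third_point c d \in S.
  by have := third_point_bichromatic bS' cd cS dS; rewrite inE negbK.
have [xc xd _] := third_pointP cd; set x := third_point c d in xS xc xd.
have tc : third_point x c = d by rewrite third_pointC 1?eq_sym // third_pointK.
have td : third_point x d = c.
  rewrite third_pointC 1?eq_sym // /x -(third_pointC cd).
  by rewrite third_pointK // eq_sym.
pose missed := ~: S :\: third_point x @: (S :\ x).
have card_missed : #|missed| + #|S| = #|~: S|.+1.
  rewrite cardsD (setIidPr (sub_third_point bS xS)) -(card_third_point xS).
  have := subset_leq_card (sub_third_point bS xS); lia.
have missedP e : e \notin S -> third_point x e \notin S -> e \in missed.
  move=> eS tS; rewrite !inE eS andbT; apply: contra tS => /imsetP[y yS ->].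
  by move: yS; rewrite !inE => /andP[yx yS]; rewrite third_pointK // eq_sym.
have cd_missed : [set c; d] \subset missed.
  by rewrite subUset !sub1set !missedP ?tc ?td //; move: cS dS; rewrite !inE.
have := subset_leq_card cd_missed; rewrite cards2 cd => missed_ge2.
(* Embedding [~: S :\ c] in [S] bounds [#|~: S|] by [#|S|.+1], so [missed] has at most two
   elements. *)
have subc := subset_leq_card (sub_third_point bS' cS).
rewrite setCK in subc; have cardc := card_third_point cS.
have : 0 < #|~: S :\: [set c; d]|.
  rewrite cardsD; have := subset_leq_card (subsetIr (~: S) [set c; d]).
  by rewrite cards2 cd; lia.
case/card_gt0P => e; rewrite !inE negb_or -andbA => /and3P[ec ed eS].
have eS' : e \in ~: S by rewrite inE.
have /eqP onto : third_point e @: (~: S :\ e) == S.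
  rewrite eqEcard; have := sub_third_point bS' eS'.
  rewrite setCK => ->; move: (card_third_point eS') card_missed missed_ge2.
  by clear; lia.
have := xS; rewrite -onto => /imsetP[y]; rewrite !inE => /andP[ye yS] xE.
have ey : e != y by rewrite eq_sym.
have [xe xy _] := third_pointP ey; rewrite -xE in xe xy.
have e_missed : e \in missed.
  by apply: missedP; rewrite // third_pointC 1?eq_sym // xE third_pointK.
have : [set c; d; e] \subset missed by rewrite subUset cd_missed sub1set.
move/subset_leq_card; rewrite setUC cardsU1 !inE negb_or ec ed cards2 cd /=.
by move: subc cardc card_missed; clear; lia.
Qed.

End ThirdPoint.

Local Open Scope ring_scope.
Local Open Scope classical_set_scope.

(** * Ideals, primes and vanishing coefficients *)

Lemma ideal_ideal_gen (R : comNzRingType) (A : set R) : ideal (ideal_gen A).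
Proof.
split=> [I [[]]//|f g If Ig I AI|a f If I AI]; have [[_ ID IM] _] := AI.
  by apply: ID; [apply: If | apply: Ig].
by apply: IM; apply: If.
Qed.

Lemma prime_ideal_prod (R : comNzRingType) (P : set R) (I : Type) (r : seq I)
    (F : I -> R) :
  prime_ideal P -> P (\prod_(i <- r) F i) -> exists i, P (F i).
Proof.
move=> [[_ P1 _] Pprime]; elim: r => [|i r IH].
  (* The empty product is 1, which lies outside the proper ideal [P]. *)
  by rewrite big_nil => /mem_set; rewrite (negPf P1).
rewrite big_cons => /mem_set/Pprime /orP[/set_mem PF|/set_mem /IH //].
by exists i.
Qed.

(* The monomial ideals used below are all of this form, for the complement [D]
   of their set of monomials. *)
Lemma ideal_vanishing (n : nat) (R : comNzRingType) (D : set 'X_{1.. n}) :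
  (forall m1 m2, D (m1 + m2)%MM -> D m2) ->
  ideal [set f : {mpoly R[n]} | forall m, D m -> mcoeff m f = 0].
Proof.
move=> D_down; split=> [m _|f g f0 g0 m Dm|a f f0 m Dm] /=.
- exact: mcoeff0.
- by rewrite mcoeffD f0 // g0 // addr0.
- rewrite mcoeffM big1 // => -[m1 m2] /= /eqP mE.
  by rewrite f0 ?mulr0 //; apply: (D_down m1); rewrite -mE.
Qed.

(** * Cover ideals and the product of all variables *)

Section Cover.
Variables (k : fieldType) (V : finType).
Implicit Types (f : {mpoly k[#|V|]}) (m : 'X_{1.. #|V|}).

Lemma var_ideal_pvar (s : {set V}) i : i \in s -> var_ideal k s (pvar k i).
Proof. by move=> si I [_]; apply; exists i. Qed.

(** The polynomials whose coefficients vanish at all monomials free of the variables of [s] form an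
    ideal containing the generators of [var_ideal k s]. *)
Lemma var_ideal_mcoeff (s : {set V}) f m : var_ideal k s f ->
  mcoeff m f != 0 -> exists2 i, i \in s & (0 < m (enum_rank i))%N.
Proof.
move=> sf; apply: contra_neqP => no_i.
pose D m' := forall i, i \in s -> m' (enum_rank i) = 0%N.
have Dm : D m.
  move=> i si; apply/eqP; rewrite -leqn0 leqNgt; apply/negP => mi.
  by apply: no_i; exists i.
apply: (sf [set g | forall m', D m' -> mcoeff m' g = 0]) Dm.
split=> [|_ [i si ->] m' Dm'].
  apply: ideal_vanishing => m1 m2 D12 i si.
  by apply/eqP; have /eqP := D12 i si; rewrite mnmDE addn_eq0 => /andP[].
rewrite mcoeffX; case: eqP => // mE.
by have := Dm' i si; rewrite -mE mnm1E eqxx.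
Qed.

Lemma ideal_cover_ideal (B : {set {set V}}) : ideal (cover_ideal k B).
Proof.
pose vars (b : {set V}) := [set f | exists2 i, i \in b & f = pvar k i].
split=> [b _|f g Bf Bg b Bb|a f Bf b Bb];
  have [I0 ID IM] := ideal_ideal_gen (vars b).
- exact: I0.
- by apply: ID; [apply: Bf | apply: Bg].
- by apply: IM; apply: Bf.
Qed.

Lemma prime_sup_cover_ideal (B : {set {set V}}) (P : set {mpoly k[#|V|]}) :
  prime_ideal P -> cover_ideal k B `<=` P ->
  exists2 b, b \in B & forall i, i \in b -> P (pvar k i).
Proof.
move=> Pprime BP; apply: contrapT => no_b.
have escape b : b \in B -> exists i, i \in b /\ ~ P (pvar k i).
  move=> Bb; apply: contrapT => no_i; apply: no_b; exists b => // i bi.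
  by apply: contrapT => nP; apply: no_i; exists i.
have /boolp.choice[j jP] (b : {b | b \in B}) :
    exists i, i \in val b /\ ~ P (pvar k i).
  by case: b => b; apply: escape.
have /BP/(prime_ideal_prod Pprime)[b] :
    cover_ideal k B (\prod_(b : {b | b \in B}) pvar k (j b)).
  (* The factor chosen for [b] itself puts the product in [var_ideal k b]. *)
  move=> b Bb; rewrite (bigD1 (exist _ b Bb)) //= mulrC.
  have [_ _ IM] := ideal_ideal_gen [set f | exists2 i, i \in b & f = pvar k i].
  by apply: IM; apply: var_ideal_pvar; have [] := jP (exist _ b Bb).
by have [] := jP b.
Qed.

Lemma prod_pvar_symbolic_power (B : {set {set V}}) n :
  (forall b, b \in B -> #|b| = n) ->
  symbolic_power (cover_ideal k B) n (\prod_(i : V) pvar k i).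
Proof.
move=> B_n P [Pprime [f Pf]].
have BP : cover_ideal k B `<=` P.
  move=> g Bg; have [_ _ IM] := ideal_cover_ideal B.
  by rewrite Pf /= mulrC; apply: IM.
have [b Bb bP] := prime_sup_cover_ideal Pprime BP.
(* With [n] replaced by [#|b|], [enum_val] lists the variables of [b] as the [n] factors required;
   the other variables form the cofactor. *)
have {B_n} nb := B_n b Bb; case: n / nb; rewrite (bigID (mem b)) /= mulrC.
have [_ _ IM] := ideal_ideal_gen [set g | exists2 u : 'I_#|b| -> _,
  (forall j, P (u j)) & g = \prod_(j < #|b|) u j].
apply: IM => I [_]; apply; exists (fun j => pvar k (enum_val j)) => [j|].
  by apply: bP; apply: enum_valP.
exact: big_enum_val.
Qed.

(** Without such an [S], every product of two elements of the cover ideal has zero coefficients at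
    the squarefree monomials [D], whereas [ones] has coefficient 1 in the product of all
    variables. *)
Lemma cover_ideal2_bichromatic (B : {set {set V}}) :
  ideal_power (cover_ideal k B) 2 (\prod_(i : V) pvar k i) ->
  exists S, bichromatic B S.
Proof.
move=> xV2; apply: contrapT => no_S.
pose D m := forall i, (m i <= 1)%N.
have Dideal : ideal [set f : {mpoly k[#|V|]} | forall m, D m -> mcoeff m f = 0].
  apply: ideal_vanishing => m1 m2 D12 i.
  by apply: leq_trans (D12 i); rewrite mnmDE leq_addl.
pose ones : 'X_{1.. #|V|} := [multinom 1%N | i < #|V|].
have Dones : D ones by move=> i; rewrite mnmE.
suff : mcoeff ones (\prod_(i : V) pvar k i) = 0.
  have -> : \prod_(i : V) pvar k i = 'X_[ones].
    rewrite mpolyXE_id (reindex _ (onW_bij _ (enum_rank_bij V))) /=.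
    by apply: eq_bigr => i _; rewrite mnmE expr1.
  by rewrite mcoeffX eqxx => /eqP; rewrite oner_eq0.
apply: (xV2 [set f | forall m, D m -> mcoeff m f = 0]) Dones.
split=> // _ [u Bu ->] m Dm.
rewrite big_ord_recl big_ord1 mcoeffM big1 // => -[m1 m2] /= /eqP mE.
apply: contrapT => /eqP; rewrite mulf_eq0 negb_or => /andP[u1 u2].
(* The support of [m1] serves as [S]. It meets every block, as does that of [m2], and the two are
   disjoint because [m1 + m2] is squarefree. *)
apply: no_S; exists [set i | (0 < bmnm m1 (enum_rank i))%N]%SET => b Bb.
have [i bi m1i] := var_ideal_mcoeff (Bu _ b Bb) u1.
have [j bj m2j] := var_ideal_mcoeff (Bu _ b Bb) u2.
exists i, j; rewrite !finset.inE; split=> //; rewrite -leqNgt.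
have /= mj := congr1 (fun m' : 'X_{1.. #|V|} => m' (enum_rank j)) mE.
rewrite -(leq_add2r 1) (leq_trans _ (Dm (enum_rank j))) // mj mnmDE.
by rewrite leq_add2l.
Qed.

End Cover.

Theorem proposition4p9 (v : nat) (hv : (3 < v)%N) (V : finType)
    (B : {set {set V}}) (hB : steiner_triple_system v B) (k : fieldType) :
  ~ (symbolic_power (cover_ideal k B) 3 `<=` ideal_power (cover_ideal k B) 2).
Proof.
have [cardV blocks3 blocks_cover] := hB.
move=> /(_ _ (prod_pvar_symbolic_power blocks3)).
case/cover_ideal2_bichromatic => S /(bichromatic_card blocks3 blocks_cover).
by rewrite cardV leqNgt hv.
Qed.
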